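(* Let $\Gamma$ be a finite simple graph with no isolated vertices and let $m\ge3$ be an integer. Then the $m$-coclique extension $\Gamma\otimes J_m$ does not admit perfect state transfer (for the Grover walk).
   Context: For a graph $\Gamma$ and a positive integer $m$, the $m$-coclique extension $\Gamma\otimes J_m$ is the graph with vertex set $V(\Gamma)\times\{1,\dots,m\}$ in which $(x,i)$ and $(y,j)$ are adjacent if and only if $\{x,y\}\in E(\Gamma)$; equivalently its adjacency matrix is $A(\Gamma)\otimes J_m$ with $J_m$ the $m\times m$ all-ones matrix. Grover walk: for a graph $G=(V,E)$ with no isolated vertices, let $\mathcal{A}=\{(x,y),(y,x)\mid \{x,y\}\in E\}$; for $a=(x,y)$ let $t(a)=y$ and $a^{-1}=(y,x)$. Define $d\in\mathbb{C}^{V\times\mathcal{A}}$ by $d_{x,a}=\frac{1}{\sqrt{\deg x}}\delta_{x,t(a)}$, $R\in\mathbb{C}^{\mathcal{A}\times\mathcal{A}}$ by $R_{a,b}=\delta_{a,b^{-1}}$, and $U=R(2d^*d-I)$. With $e_x$ the standard unit vector at $x\in V$, $G$ admits perfect state transfer if there exist distinct vertices $x\ne y$, an integer $\tau\ge1$ and $\gamma\in\mathbb{C}$ with $|\gamma|=1$ such that $U^\tau d^*e_x=\gamma\, d^*e_y$. *)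

(* Defs.v *)
From HB Require Import structures.
From mathcomp Require Import all_boot all_order all_algebra.
From mathcomp Require Import reals.
From mathcomp.real_closed Require Import complex.

Set Implicit Arguments.
Unset Strict Implicit.
Unset Printing Implicit Defensive.

Import Order.TTheory GRing.Theory Num.Theory.

Local Open Scope ring_scope.
Local Open Scope sesquilinear_scope.

Record sgraph := SGraph {
  vertex :> finType;
  adj : rel vertex;
  adj_sym : symmetric adj;
  adj_irr : irreflexive adj
}.

Definition deg (G : sgraph) (x : G) : nat := #|[set y | adj x y]|.

Definition no_isolated (G : sgraph) : Prop :=
  forall x : G, exists y : G, adj x y.

Section CocliqueExtension.
Variables (G : sgraph) (m : nat).

Definition coclique_adj : rel (G * 'I_m) := fun u v => adj u.1 v.1.

Lemma coclique_adj_sym : symmetric coclique_adj.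
Proof. by move=> u v; exact: adj_sym. Qed.

Lemma coclique_adj_irr : irreflexive coclique_adj.
Proof. by move=> u; exact: adj_irr. Qed.

Definition coclique_ext : sgraph := SGraph coclique_adj_sym coclique_adj_irr.

Lemma no_isolated_coclique_ext : no_isolated G -> no_isolated coclique_ext.
Proof. by move=> isoG [x i]; have [y xy] := isoG x; exists (y, i). Qed.

End CocliqueExtension.

Section GroverWalk.
Variables (C : numClosedFieldType) (G : sgraph).

(* The arc (x, y) runs from x to y. *)
Definition arc := {a : G * G | adj a.1 a.2}.

Definition arc_head (a : arc) : G := (val a).2.

Lemma arc_inv_subproof (a : arc) : adj (val a).2 (val a).1.
Proof. by rewrite adj_sym (valP a). Qed.

Definition arc_inv (a : arc) : arc :=
  exist _ ((val a).2, (val a).1) (arc_inv_subproof a).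

(* Matrices and vectors indexed by V or by the arcs are indexed by ordinals
   through the canonical enumerations enum_val / enum_rank. *)

Definition boundary_mx : 'M[C]_(#|G|, #|{: arc}|) :=
  \matrix_(i, j)
    ((sqrtC (deg (enum_val i))%:R)^-1 *
     (enum_val i == arc_head (enum_val j))%:R).

Definition shift_mx : 'M[C]_#|{: arc}| :=
  \matrix_(i, j) (enum_val i == arc_inv (enum_val j))%:R.

Definition grover_mx : 'M[C]_#|{: arc}| :=
  shift_mx *m (2%:R *: (boundary_mx^t* *m boundary_mx) - 1%:M).

Definition unit_vec (x : G) : 'cV[C]_#|G| := delta_mx (enum_rank x) 0.

Definition perfect_state_transfer : Prop :=
  exists (x y : G) (tau : nat) (gamma : C),
    [/\ x != y, (1 <= tau)%N, `|gamma| = 1 &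
        (grover_mx ^+ tau) *m (boundary_mx^t* *m unit_vec x)
          = gamma *: (boundary_mx^t* *m unit_vec y)].

End GroverWalk.

(* Main.v *)
Require Import Defs.
From mathcomp Require Import all_boot all_order all_algebra.
From mathcomp Require Import reals.
From mathcomp.real_closed Require Import complex.

Set Implicit Arguments.
Unset Strict Implicit.
Unset Printing Implicit Defensive.

Import Order.TTheory GRing.Theory Num.Theory.

Local Open Scope ring_scope.
Local Open Scope sesquilinear_scope.

(** Vertices y and z are twins when they have the same neighbours.  With
    d d^* = 1 and R^2 = 1, the space of arc vectors R d^* a + d^* b is stable
    under U: it sends (a, b) to (2 P a + b, - a), where P = d R d^* is the
    normalized adjacency matrix.  Rows y and z of P agree, so from a start at
    x outside {y, z} the coordinates of a and b at y and z stay equal, and so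
    do those of d U^tau d^* e_x.  Perfect state transfer from x to y would
    make this vector gamma e_y, forcing gamma = 0.  In an m-coclique extension
    with m >= 3, every y has a twin other than x. *)

(** Matrix products contracted over arcs become double sums over tail and head, where the deltas in
    [d] and [R] leave few terms. *)
Lemma sum_arc (V : nmodType) (G : sgraph) (F : G -> G -> V) :
  \sum_(j < #|{: Defs.arc G}|) F (val (enum_val j)).1 (val (enum_val j)).2
    = \sum_u \sum_(v | adj u v) F u v.
Proof.
rewrite -(big_enum_val (fun a : Defs.arc G => F (val a).1 (val a).2)) /=.
rewrite pair_big_dep /=.
rewrite (big_sub [pred p : G * G | adj p.1 p.2] (fun p => F p.1 p.2)).
by apply: eq_bigl => a; rewrite inE.
Qed.

Section GroverTwins.
Variables (C : numClosedFieldType) (G : sgraph).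

Local Notation d := (boundary_mx C G).
Local Notation R := (shift_mx C G).

Lemma arc_invK : involutive (@arc_inv G).
Proof. by case=> -[u v] uv; apply: val_inj. Qed.

Lemma shift_mxK : R *m R = 1%:M.
Proof.
apply/matrixP=> i j; rewrite !mxE.
rewrite (bigD1 (enum_rank (arc_inv (enum_val j)))) //= big1 => [|k kj].
  rewrite !mxE enum_rankK eqxx mulr1 addr0 arc_invK.
  by rewrite (inj_eq enum_val_inj).
rewrite !mxE; case: (eqVneq (enum_val k)) => [ek|_]; last by rewrite mulr0.
by rewrite -ek enum_valK eqxx in kj.
Qed.

Lemma boundary_adjE j u :
  (d^t*) j u = (sqrtC (deg (enum_val u))%:R)^-1 *
               (enum_val u == arc_head (enum_val j))%:R.
Proof.
rewrite !mxE conj_Creal // realM ?realV ?realn //.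
by rewrite ger0_real // sqrtC_ge0 ler0n.
Qed.

(** Each arc has one head, so distinct rows of [d] have disjoint supports; row [x] has [deg x]
    nonzero entries, each of square [1 / deg x]. *)
Lemma boundary_coisometry : no_isolated G -> d *m d^t* = 1%:M.
Proof.
move=> isoG; apply/matrixP=> u v; rewrite mxE.
under eq_bigr do rewrite boundary_adjE mxE /arc_head.
set x := enum_val u; set y := enum_val v.
rewrite (sum_arc (fun _ w => (sqrtC (deg x)%:R)^-1 * (x == w)%:R *
                             ((sqrtC (deg y)%:R)^-1 * (y == w)%:R))).
rewrite mxE.
have [uv|uv] := eqVneq u v; last first.
  rewrite !big1 // => w _; rewrite big1 // => t _.
  have [xt|_] := eqVneq x t; last by rewrite mulr0 mul0r.
  have [yt|_] := eqVneq y t; last by rewrite !mulr0.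
  by case/eqP: uv; apply: enum_val_inj; rewrite -/x -/y xt yt.
rewrite /y -uv -/x {y uv}.
have degx : (deg x)%:R != 0 :> C.
  have [y xy] := isoG x; rewrite pnatr_eq0 -lt0n; apply/card_gt0P.
  by exists y; rewrite inE.
(* For a fixed tail [w], the only head that contributes is [x], and only if [w] is a neighbour of
   [x]. *)
transitivity (\sum_(w in [set w | adj x w]) (deg x)%:R^-1 : C).
  rewrite [RHS]big_mkcond; apply: eq_bigr => w _; rewrite inE adj_sym.
  case: ifP => [wx|/negbT wx].
    rewrite (bigD1 x) //= eqxx !mulr1 big1 => [|t /andP[_ /negPf tx]].
      by rewrite addr0 -invfM -expr2 sqrtCK.
    by rewrite [x == t]eq_sym tx mulr0 mul0r.
  rewrite big1 // => t wt; have [xt|_] := eqVneq x t; last by rewrite mulr0 mul0r.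
  by rewrite -xt (negPf wx) in wt.
by rewrite sumr_const -[LHS]mulr_natl; exact: mulfV.
Qed.

Definition twins (y z : G) := forall w, adj y w = adj z w.

(** Reversing arcs turns the head test of [d^t*] into a tail test. *)
Lemma shift_adjE j u :
  (R *m d^t*) j u = (sqrtC (deg (enum_val u))%:R)^-1 *
                    (enum_val u == (val (enum_val j)).1)%:R.
Proof.
rewrite mxE (bigD1 (enum_rank (arc_inv (enum_val j)))) //= big1 => [|k kj].
  rewrite boundary_adjE mxE enum_rankK arc_invK eqxx mul1r addr0.
  by rewrite /arc_head.
rewrite mxE; case: eqP => [ej|_]; last by rewrite mul0r.
by rewrite ej arc_invK enum_valK eqxx in kj.
Qed.

Definition walk_mx := d *m R *m d^t*.

(** [d] fixes the head and [R *m d^t*] fixes the tail, so at most one arc survives in the sum. *)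
Lemma walk_mxE y z : walk_mx (enum_rank y) z =
  (sqrtC (deg y)%:R)^-1 * (sqrtC (deg (enum_val z))%:R)^-1
    * (adj y (enum_val z))%:R.
Proof.
rewrite /walk_mx -mulmxA mxE; set w := enum_val z.
under eq_bigr do rewrite shift_adjE mxE enum_rankK /arc_head -/w.
rewrite (sum_arc (fun t u => (sqrtC (deg y)%:R)^-1 * (y == u)%:R *
                             ((sqrtC (deg w)%:R)^-1 * (w == t)%:R))).
rewrite (bigD1 w) //= [X in _ + X]big1 ?addr0 => [|t tw]; last first.
  by rewrite big1 // => u _; rewrite [w == t]eq_sym (negPf tw) !mulr0.
rewrite adj_sym; case: (boolP (adj w y)) => wy.
  rewrite (bigD1 y) //= big1 ?addr0 => [|u /andP[_ uy]].
    by rewrite !eqxx !mulr1.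
  by rewrite [y == u]eq_sym (negPf uy) mulr0 mul0r.
rewrite mulr0 big1 // => u wu.
have [yu|_] := eqVneq y u; last by rewrite mulr0 mul0r.
by rewrite -yu (negPf wy) in wu.
Qed.

Lemma twins_deg y z : twins y z -> deg y = deg z.
Proof. by move=> yz; apply: eq_card => w; rewrite !inE yz. Qed.

Lemma walk_twins y z (a : 'cV[C]_#|G|) : twins y z ->
  (walk_mx *m a) (enum_rank y) 0 = (walk_mx *m a) (enum_rank z) 0.
Proof.
move=> yz; rewrite !mxE; apply: eq_bigr => k _.
by rewrite !walk_mxE yz (twins_deg yz).
Qed.

(** As [d^t* *m d] is the projection onto the range of [d^t*], the reflection in [U] fixes [d^t* b]
    and sends [R d^t* a] to [2 d^t* P a - R d^t* a]. *)
Lemma grover_mx_step (a b : 'cV[C]_#|G|) : no_isolated G ->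
  grover_mx C G *m (R *m d^t* *m a + d^t* *m b)
    = R *m d^t* *m (2%:R *: (walk_mx *m a) + b) + d^t* *m (- a).
Proof.
move=> isoG; have dd := boundary_coisometry isoG.
have E c : d^t* *m d *m (d^t* *m c) = d^t* *m c :> 'cV_ _.
  by rewrite -!mulmxA (mulmxA d) dd mul1mx.
rewrite /grover_mx -mulmxA.
(* By [R^2 = 1], the term [d^t* (- a)] is [R] applied to [- R d^t* a], so [R] factors out and only
   the reflection is left to compute. *)
have -> : R *m d^t* *m (2%:R *: (walk_mx *m a) + b) + d^t* *m (- a)
  = R *m (2%:R *: (d^t* *m (walk_mx *m a)) + d^t* *m b - R *m (d^t* *m a)).
  by rewrite !mulmxDr !mulmxN -!scalemxAr !mulmxA shift_mxK mul1mx.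
congr (_ *m _); rewrite mulmxBl mul1mx -scalemxAl mulmxDr E scalerDr.
rewrite /walk_mx !mulmxA [2%:R *: (_ *m b)]scaler_nat mulr2n.
by rewrite [X in _ - X]addrC opprD !addrA addrK.
Qed.

Lemma no_perfect_state_transfer_to_twin (x y z : G) tau (gamma : C) :
    no_isolated G -> twins y z -> x != y -> x != z -> y != z -> gamma != 0 ->
  (grover_mx C G ^+ tau) *m (d^t* *m unit_vec C x)
    <> gamma *: (d^t* *m unit_vec C y).
Proof.
move=> isoG yz xy xz neq_yz gamma0 pst.
pose eq_at (a : 'cV[C]_#|G|) := a (enum_rank y) 0 = a (enum_rank z) 0.
have eq_at_lin (s : C) v w : eq_at v -> eq_at w -> eq_at (s *: v + w).
  by rewrite /eq_at => ev ew; rewrite !mxE ev ew.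
have unit_at v w : unit_vec C v (enum_rank w) 0 = (v == w)%:R.
  by rewrite mxE eqxx andbT (inj_eq enum_rank_inj) eq_sym.
have [a [b [Uab ea eb]]] : exists a b : 'cV[C]_#|G|,
    [/\ grover_mx C G ^+ tau *m (d^t* *m unit_vec C x)
          = R *m d^t* *m a + d^t* *m b, eq_at a & eq_at b].
  elim: tau {pst} => [|n [a [b [IH ea eb]]]].
    (* The start is [d^t* e_x]; [e_x] vanishes at both [y] and [z] because [x] differs from each. *)
    exists 0, (unit_vec C x); split.
    - by rewrite expr0 mul1mx mulmx0 add0r.
    - by rewrite /eq_at !mxE.
    - by rewrite /eq_at !unit_at (negPf xy) (negPf xz).
  exists (2%:R *: (walk_mx *m a) + b), (- a); split.
  - by rewrite exprS -[LHS]mulmxA IH grover_mx_step.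
  - exact: eq_at_lin (walk_twins a yz) eb.
  - by rewrite /eq_at mxE ea [RHS]mxE.
(* Applying [d] returns to vertex space: [P a + b = gamma e_y], whose left side agrees at [y] and
   [z]. *)
move: pst; rewrite {}Uab => /(congr1 (mulmx d)).
rewrite mulmxDr -scalemxAr !mulmxA boundary_coisometry // !mul1mx -/walk_mx.
move=> pst; have : eq_at (gamma *: unit_vec C y).
  by rewrite -pst -[walk_mx *m a]scale1r; apply: eq_at_lin (walk_twins a yz) eb.
rewrite /eq_at [LHS]mxE [RHS]mxE !unit_at eqxx (negPf neq_yz) mulr1 mulr0.
by move/eqP; rewrite (negPf gamma0).
Qed.

End GroverTwins.

Theorem theorem6p2 (R : realType) (Gamma : sgraph) (m : nat)
  (hGamma : no_isolated Gamma) (hm : (3 <= m)%N) :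
  ~ perfect_state_transfer R[i] (coclique_ext Gamma m).
Proof.
case=> -[u i] [[v j] [tau [gamma [xy _ gamma1 pst]]]].
(* Adjacency ignores the index, so [(v, k)] is a twin of [(v, j)]; [k != i] keeps it distinct from
   the start even when [u = v]. Avoiding two indices is where [3 <= m] enters. *)
have [k] : exists k, k \in ~: [set i; j].
  apply/card_gt0P; rewrite cardsCs setCK card_ord cards2 subn_gt0.
  by apply: leq_trans hm; case: (_ != _).
rewrite !inE negb_or => /andP[ki kj].
apply: (@no_perfect_state_transfer_to_twin R[i] (coclique_ext Gamma m)
          (u, i) (v, j) (v, k) tau gamma) pst => //.
- exact: no_isolated_coclique_ext.
- by rewrite xpair_eqE negb_and [i == k]eq_sym ki orbT.
- by rewrite xpair_eqE negb_and [j == k]eq_sym kj orbT.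
- by rewrite -normr_eq0 gamma1 oner_neq0.
Qed.
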